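(* Let $n\ge 3$ and let $m$ be a positive integer. For all linear maps $L:(\mathbb{R}^{n\times n})^m\to\mathbb{R}^2$ and all $A_1,\dots,A_m\in\mathbb{R}^{n\times n}$, the sets $L(\boldsymbol{O}_1(A_1,\dots,A_m))$ and $L(\boldsymbol{O}_2(A_1,\dots,A_m))$ are convex.
   Context: $\mathrm{SO}_n=\{U\in\mathbb{R}^{n\times n}:U^tU=UU^t=I_n,\ \det U>0\}$. For $A_1,\dots,A_m\in\mathbb{R}^{n\times n}$, $\boldsymbol{O}_1(A_1,\dots,A_m)=\{(A_1V,\dots,A_mV):V\in\mathrm{SO}_n\}$ and $\boldsymbol{O}_2(A_1,\dots,A_m)=\{(UA_1,\dots,UA_m):U\in\mathrm{SO}_n\}$, as subsets of $(\mathbb{R}^{n\times n})^m$. *)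

(* Defs.v *)
From HB Require Import structures.
From mathcomp Require Import all_boot all_order all_algebra.
From mathcomp Require Import boolp classical_sets reals convex.

Set Implicit Arguments.
Unset Strict Implicit.
Unset Printing Implicit Defensive.

Import Order.TTheory GRing.Theory Num.Theory.
Local Open Scope classical_set_scope.
Local Open Scope ring_scope.

Definition SO (R : realType) (n : nat) : set 'M[R]_n :=
  [set U | [/\ U^T *m U = 1%:M, U *m U^T = 1%:M & 0 < \det U]].

Definition O1 (R : realType) (n m : nat) (A : {ffun 'I_m -> 'M[R]_n}) :
    set {ffun 'I_m -> 'M[R]_n} :=
  [set [ffun i => A i *m V] | V in @SO R n].

Definition O2 (R : realType) (n m : nat) (A : {ffun 'I_m -> 'M[R]_n}) :
    set {ffun 'I_m -> 'M[R]_n} :=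
  [set [ffun i => U *m A i] | U in @SO R n].

(* Main.v *)
Require Import Defs.
From HB Require Import structures.
From mathcomp Require Import all_boot all_order all_algebra.
From mathcomp Require Import boolp classical_sets reals interval_inference convex.
From mathcomp Require Import ring lra.
From mathcomp Require complex.

Set Implicit Arguments.
Unset Strict Implicit.
Unset Printing Implicit Defensive.

Import Order.TTheory GRing.Theory Num.Theory.
Local Open Scope classical_set_scope.
Local Open Scope ring_scope.

(** Both orbit images are images of [SO R n] under a linear map
    [f : 'M_n -> 'rV_2], so it suffices that such an [f] maps the rotation
    group onto a convex set when [3 <= n].  After translating by [U^T], a
    segment between two points of the image is the image of the segment from
    the identity to a rotation [V].

    The rotation [V] turns finitely many mutually orthogonal planes and fixes
    everything else.  On a turned plane, identified with the complex numbers,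
    [V] is multiplication by a point of the unit circle, and a point
    [1 + t (V - 1)] of the segment is multiplication by a point of the closed
    unit disc.  As long as two planes carry interior points of the disc, these
    two points have four real parameters, which [f] maps to two; so one can move
    along the kernel of [f] until one of them reaches its circle
    ([slide_to_circle]).  In the end all the planes but one are rotated, and the
    point has the same image as [W + plane_part p q a b] where [W] is a rotation
    fixing the orthonormal pair [p], [q] and [a ^+ 2 + b ^+ 2 <= 1]
    ([segment_to_disc]).

    Such a point lies on a chord of a circle of rotations of the form
    [M *m reflection u], with [M] orthogonal of determinant [-1] and [u] in the
    plane of [p] and [q].  That the image of the chord is in [f @` SO]
    ([segment_reflections]) is an instance of Brickman's theorem on the
    numerical range of two real quadratic forms: after multiplication by
    [dot u u], the map sending [u] to [f (M *m reflection u) - c] is quadratic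
    in [u] for every constant [c], and two quadratic forms in at least three
    variables have a common nontrivial zero as soon as two values of the pair of
    forms point in opposite directions ([common_zero]).  This is where [3 <= n]
    enters: for [n = 2] the image can be an ellipse without its interior. *)

(** * Common zeros of two quadratic forms *)

Lemma quartic_ivt (R : rcfType) (a b c d e : R) : a > 0 -> b < 0 ->
  exists s t : R, s + t = 1 /\
    s ^+ 4 * a + t ^+ 4 * b + s ^+ 2 * t ^+ 2 * c
    + s ^+ 3 * t * d + s * t ^+ 3 * e = 0.
Proof.
move=> a_gt0 b_lt0.
pose p : {poly R} := - ((1 - 'X) ^+ 4 * a%:P + 'X ^+ 4 * b%:P
  + (1 - 'X) ^+ 2 * 'X ^+ 2 * c%:P
  + (1 - 'X) ^+ 3 * 'X * d%:P + (1 - 'X) * 'X ^+ 3 * e%:P).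
have pE t : p.[t] = - ((1 - t) ^+ 4 * a + t ^+ 4 * b
  + (1 - t) ^+ 2 * t ^+ 2 * c
  + (1 - t) ^+ 3 * t * d + (1 - t) * t ^+ 3 * e) by rewrite /p !hornerE.
have [||t _ /rootP pt] := @poly_ivt _ p 0 1; first exact: ler01.
  by rewrite !pE; apply/andP; split; lra.
by exists (1 - t), t; split; [lra | apply: oppr_inj; rewrite -pE pt oppr0].
Qed.

Lemma exists_kernel_vector (R : fieldType) (m n : nat)
    (phi : 'rV[R]_m -> 'rV[R]_n) :
  (n < m)%N -> linear phi -> exists2 z, z != 0 & phi z = 0.
Proof.
move=> ltnm phi_lin; pose phim := GRing.isLinear.Build _ _ _ _ phi phi_lin.
pose phiL : {linear 'rV[R]_m -> 'rV[R]_n} := HB.pack phi phim.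
have: kermx (lin1_mx phiL) != 0.
  rewrite -mxrank_eq0 mxrank_ker -lt0n subn_gt0.
  exact: leq_ltn_trans (rank_leq_col _) ltnm.
case/rowV0Pn=> z /sub_kermxP zphi z_neq0.
by exists z; rewrite // -[phi]/(phiL : _ -> _) -mul_rV_lin1.
Qed.

Section LinearFunctions.
Variables (R : nzRingType) (E F : lmodType R) (f : E -> F).
Hypothesis f_lin : linear f.

Lemma linear_fun0 : f 0 = 0.
Proof.
by have := f_lin (-1) 0 0; rewrite scaleN1r oppr0 addr0 scaleN1r addNr.
Qed.

Lemma linear_funZ c X : f (c *: X) = c *: f X.
Proof. by rewrite -[c *: X]addr0 f_lin linear_fun0 addr0. Qed.

Lemma linear_funD X Y : f (X + Y) = f X + f Y.
Proof. by rewrite -[X]scale1r f_lin !scale1r. Qed.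

Lemma linear_fun_addZ c X Y : f (X + c *: Y) = f X + c *: f Y.
Proof. by rewrite addrC f_lin addrC. Qed.
End LinearFunctions.

Definition symmetric_bilinear (R : nzRingType) (V : lmodType R) (b : V -> V -> R) :=
  (forall u v, b u v = b v u) /\
  (forall a u v w, b (a *: u + v) w = a * b u w + b v w).

Section Forms.
Variables (R : rcfType) (V : lmodType R).
Implicit Types (b g h : V -> V -> R) (u v w x y z : V).

Lemma form0l b v : symmetric_bilinear b -> b 0 v = 0.
Proof.
by case=> _ lin; have := lin 1 0 0 v; rewrite scaler0 addr0; lra.
Qed.

Lemma formDl b u v w : symmetric_bilinear b -> b (u + v) w = b u w + b v w.
Proof. by case=> _ lin; have := lin 1 u v w; rewrite scale1r mul1r. Qed.

Lemma formZl b a u w : symmetric_bilinear b -> b (a *: u) w = a * b u w.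
Proof.
by move=> sb; case: (sb) => _ /(_ a u 0 w); rewrite (form0l w sb) !addr0.
Qed.

Lemma formDr b u v w : symmetric_bilinear b -> b u (v + w) = b u v + b u w.
Proof. by move=> sb; rewrite !(sb.1 u) formDl. Qed.

Lemma formZr b a u w : symmetric_bilinear b -> b u (a *: w) = a * b u w.
Proof. by move=> sb; rewrite !(sb.1 u) formZl. Qed.

(** Squaring the coefficients of [x] and [y] makes the form a homogeneous quartic
    in which the mixed terms in [x], [y] and the square of [z] share the monomial
    [s ^+ 2 * t ^+ 2]; they can then cancel each other. *)
Lemma form_path b x y z s t : symmetric_bilinear b ->
  let q := s ^+ 2 *: x + t ^+ 2 *: y + (s * t) *: z in
  b q q = s ^+ 4 * b x x + t ^+ 4 * b y y
          + s ^+ 2 * t ^+ 2 * (2 * b x y + b z z)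
          + s ^+ 3 * t * (2 * b x z) + s * t ^+ 3 * (2 * b y z).
Proof.
move=> sb /=; rewrite !(formDl, formZl, formDr, formZr) //.
by rewrite (sb.1 y x) (sb.1 z x) (sb.1 z y); ring.
Qed.

(** The path of [form_path] from [x] to [y] stays on the cone [g = 0] when [z] is
    [g]-orthogonal to [x] and [y] and is scaled so as to cancel the mixed term;
    the form [h] changes sign along it.  Taking [z = 0] when there is no mixed term
    to cancel keeps the path away from [0]. *)
Lemma isotropic_path g h x y z :
  symmetric_bilinear g -> symmetric_bilinear h ->
  g x x = 0 -> g y y = 0 -> g z x = 0 -> g z y = 0 ->
  2 * g x y + g z z = 0 -> (g x y = 0 -> z = 0) ->
  h x x > 0 -> h y y < 0 ->
  exists2 q, q != 0 & g q q = 0 /\ h q q = 0.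
Proof.
move=> sg sh gxx gyy gzx gzy gxy z0 hx hy.
have [s [t [st hst]]] := quartic_ivt (2 * h x y + h z z)
  (2 * h x z) (2 * h y z) hx hy.
exists (s ^+ 2 *: x + t ^+ 2 *: y + (s * t) *: z); last first.
  rewrite !form_path // hst gxx gyy (sg.1 x z) (sg.1 y z) gzx gzy gxy.
  by split=> //; ring.
apply/eqP => q0.
have gq w : g (s ^+ 2 *: x + t ^+ 2 *: y + (s * t) *: z) w = 0.
  by rewrite q0 form0l.
have [gxy0|gxyN0] := eqVneq (g x y) 0.
  (* here [s^2 x = - t^2 y], which the signs of [h] forbid *)
  move: q0; rewrite z0 // scaler0 addr0 => /eqP.
  rewrite addr_eq0 -scaleNr => /eqP q0.
  have : h (s ^+ 2 *: x) (s ^+ 2 *: x) = h (- t ^+ 2 *: y) (- t ^+ 2 *: y).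
    by rewrite q0.
  rewrite !formZl // !formZr // => hxy.
  have A : s ^+ 4 * h x x >= 0 by rewrite mulr_ge0 ?exprn_even_ge0 // ltW.
  have B : t ^+ 4 * h y y <= 0 by rewrite mulr_ge0_le0 ?exprn_even_ge0 // ltW.
  have /eqP : s ^+ 4 * h x x = 0 by lra.
  rewrite mulf_eq0 expf_eq0 /= (gt_eqF hx) orbF => /eqP s0.
  have /eqP : t ^+ 4 * h y y = 0 by lra.
  rewrite mulf_eq0 expf_eq0 /= (lt_eqF hy) orbF => /eqP t0.
  by move: st; rewrite s0 t0; lra.
have := gq x; have := gq y; rewrite !formDl // !formZl // (sg.1 y x).
rewrite gxx gyy gzx gzy !mulr0 !addr0 ?add0r.
move=> /eqP; rewrite mulf_eq0 expf_eq0 /= (negPf gxyN0) orbF => /eqP s0.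
move=> /eqP; rewrite mulf_eq0 expf_eq0 /= (negPf gxyN0) orbF => /eqP t0.
by move: st; rewrite s0 t0; lra.
Qed.
End Forms.

(** If [g x y = 0] then [g] vanishes on the plane of [x] and [y], and [h] changes
    sign there.  Otherwise a third dimension provides some nonzero [z] that is
    [g]-orthogonal to [x] and [y]: when [g z z != 0], a multiple of [z] corrects
    the path from [x] to [y] or to [- y]; when [g z z = 0], the vector [z] itself
    can be paired with [x] or with [y], according to the sign of [h z z]. *)
Lemma common_zero (R : rcfType) (n : nat) (g h : 'rV[R]_n -> 'rV[R]_n -> R) x y :
  (3 <= n)%N -> symmetric_bilinear g -> symmetric_bilinear h ->
  g x x = 0 -> g y y = 0 -> h x x > 0 -> h y y < 0 ->
  exists2 q, q != 0 & g q q = 0 /\ h q q = 0.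
Proof.
move=> n3 sg sh gxx gyy hx hy.
have path0 v w : g v v = 0 -> g w w = 0 -> g v w = 0 -> h v v > 0 -> h w w < 0 ->
    exists2 q, q != 0 & g q q = 0 /\ h q q = 0.
  move=> gv gw gvw; apply: (@isotropic_path _ _ g h v w 0) => //.
  - by rewrite form0l.
  - by rewrite form0l.
  - by rewrite form0l // gvw; lra.
have [gxy0|gxyN0] := eqVneq (g x y) 0; first exact: (path0 x y).
pose phi (z : 'rV[R]_n) : 'rV[R]_2 := \row_j (if j == 0 then g z x else g z y).
have phi_lin : linear phi.
  by move=> a u v; apply/rowP=> j; rewrite !mxE; case: ifP => _; rewrite sg.2.
have [z z_neq0 phiz] := exists_kernel_vector n3 phi_lin.
have gzx : g z x = 0 by have /rowP/(_ 0) := phiz; rewrite !mxE.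
have gzy : g z y = 0 by have /rowP/(_ 1) := phiz; rewrite !mxE.
have [gzz|gzzN0] := eqVneq (g z z) 0.
  have [hz|hz|hz] := ltgtP (h z z) 0; last by exists z.
    by apply: (path0 x z) => //; rewrite sg.1.
  exact: (path0 z y).
(* some [z' = k z] satisfies [2 g(x, y') + g(z', z') = 0] when [g x y'] and [g z z]
   have opposite signs, which holds for [y' = y] or for [y' = - y] *)
suff main y' : g y' y' = 0 -> h y' y' < 0 -> g x y' != 0 -> g z y' = 0 ->
    - (2 * g x y') / g z z >= 0 -> exists2 q, q != 0 & g q q = 0 /\ h q q = 0.
  have [ge0|/ltW le0] := lerP 0 (- (2 * g x y) / g z z); first exact: (main y).
  apply: (main (- 1 *: y)); rewrite ?formZl ?formZr ?gyy ?gzy ?mulr0 //.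
  - by rewrite !mulN1r opprK.
  - by rewrite mulN1r oppr_eq0.
  - by rewrite mulN1r mulrN opprK -[_ / _]opprK oppr_ge0 -mulNr.
move=> gy' hy' gxy' gzy' ge0; pose k := Num.sqrt (- (2 * g x y') / g z z).
apply: (@isotropic_path _ _ g h x y' (k *: z)); rewrite ?formZl ?gzx ?gzy' ?mulr0 //.
  rewrite formZr // mulrA -expr2 sqr_sqrtr //.
  by field.
by move=> gxy0; rewrite gxy0 eqxx in gxy'.
Qed.

(** * Scalar products, reflections and Brickman's theorem *)

Definition dot (R : nzRingType) n (u v : 'rV[R]_n) : R := (u *m v^T) 0 0.
Definition outer (R : nzRingType) n (u v : 'rV[R]_n) : 'M[R]_n := u^T *m v.

Section Dot.
Variables (R : realFieldType) (n : nat).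
Implicit Types (u v w x y p q : 'rV[R]_n) (W : 'M[R]_n) (a b : R).

Lemma dotC u v : dot u v = dot v u.
Proof. by rewrite /dot -[u *m _]trmxK trmx_mul trmxK mxE. Qed.

Lemma dotDl u v w : dot (u + v) w = dot u w + dot v w.
Proof. by rewrite /dot mulmxDl mxE. Qed.
Lemma dotZl a u w : dot (a *: u) w = a * dot u w.
Proof. by rewrite /dot -scalemxAl mxE. Qed.
Lemma dotDr u v w : dot u (v + w) = dot u v + dot u w.
Proof. by rewrite !(dotC u) dotDl. Qed.
Lemma dotZr a u w : dot u (a *: w) = a * dot u w.
Proof. by rewrite !(dotC u) dotZl. Qed.
Lemma dot0l w : dot 0 w = 0.
Proof. by rewrite /dot mul0mx mxE. Qed.
Lemma dot_mull u W w : dot (u *m W) w = dot u (w *m W^T).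
Proof. by rewrite /dot trmx_mul trmxK mulmxA. Qed.

Lemma dot_ge0 u : 0 <= dot u u.
Proof.
by rewrite /dot mxE sumr_ge0 // => i _; rewrite mxE -expr2 sqr_ge0.
Qed.

Lemma dot_eq0 u : (dot u u == 0) = (u == 0).
Proof.
apply/idP/eqP => [|->]; last by rewrite dot0l.
rewrite /dot mxE psumr_eq0 => [/allP uu|i _]; last first.
  by rewrite mxE -expr2 sqr_ge0.
apply/rowP=> i; have := uu i (mem_index_enum i).
by rewrite !mxE -expr2 sqrf_eq0 => /eqP.
Qed.

Lemma dot_gt0 u : (0 < dot u u) = (u != 0).
Proof. by rewrite lt_def dot_ge0 dot_eq0 andbT. Qed.

Lemma mulmx_outer u p q : u *m outer p q = dot u p *: q.
Proof. by rewrite /outer mulmxA [u *m _]mx11_scalar mul_scalar_mx. Qed.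

Lemma outer_mulmx p q W : outer p q *m W = outer p (q *m W).
Proof. by rewrite /outer mulmxA. Qed.

Lemma mulmx_outerl p q W : W *m outer p q = outer (p *m W^T) q.
Proof. by rewrite /outer trmx_mul trmxK mulmxA. Qed.

Lemma tr_outer p q : (outer p q)^T = outer q p.
Proof. by rewrite /outer trmx_mul trmxK. Qed.

Lemma outerDl u v w : outer (u + v) w = outer u w + outer v w.
Proof. by rewrite /outer linearD mulmxDl. Qed.
Lemma outerDr u v w : outer w (u + v) = outer w u + outer w v.
Proof. by rewrite /outer mulmxDr. Qed.
Lemma outerZl a u w : outer (a *: u) w = a *: outer u w.
Proof. by rewrite /outer linearZ -scalemxAl. Qed.
Lemma outerZr a u w : outer w (a *: u) = a *: outer w u.
Proof. by rewrite /outer -scalemxAr. Qed.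

Definition reflection u : 'M[R]_n := 1%:M - (2 / dot u u) *: outer u u.

Lemma tr_reflection u : (reflection u)^T = reflection u.
Proof. by rewrite /reflection linearB linearZ /= trmx1 tr_outer. Qed.

Lemma reflectionK u : u != 0 -> reflection u *m reflection u = 1%:M.
Proof.
rewrite -dot_gt0 => u_gt0; rewrite /reflection mulmxBl mul1mx mulmxBr mulmx1.
rewrite -scalemxAl -scalemxAr mulmx_outerl tr_outer mulmx_outer outerZl.
move: (outer u u) => P; apply/matrixP=> i j; rewrite !mxE.
by field; rewrite gt_eqF.
Qed.

(** The determinant of [1 - c u^T u] is [1 - c u u^T], by two block
    triangular factorizations of the same matrix. *)
Lemma det_reflection u : u != 0 -> \det (reflection u) = -1.
Proof.
rewrite -dot_gt0 => u_gt0; pose c := 2 / dot u u.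
pose A : 'M[R]_(1 + n) := block_mx 1%:M (c *: u) u^T 1%:M.
have A1 : A = block_mx 1%:M 0 u^T 1%:M *m block_mx 1%:M (c *: u) 0 (reflection u).
  rewrite mulmx_block !mul0mx !mul1mx !mulmx1 ?mulmx0 !addr0 -scalemxAr.
  by rewrite -[u^T *m u]/(outer u u) addrC subrK.
have A2 : A = block_mx 1%:M (c *: u) 0 1%:M
              *m block_mx (1%:M - c *: (u *m u^T)) 0 u^T 1%:M.
  rewrite mulmx_block !mul0mx !mul1mx !mulmx1 ?mulmx0 !add0r -scalemxAl.
  by rewrite subrK.
have := congr1 determinant A2; rewrite A1 !det_mulmx !det_lblock !det_ublock.
rewrite !det1 !mul1r mulr1 => ->; rewrite det_mx11.
have -> : (1%:M - c *: (u *m u^T)) 0 0 = 1 - c * dot u u.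
  by rewrite /dot; move: (u *m u^T) => B; rewrite !mxE.
by rewrite /c; field; rewrite gt_eqF.
Qed.
End Dot.

Lemma row2P (R : nzRingType) (u v : 'rV[R]_2) :
  u 0 0 = v 0 0 -> u 0 1 = v 0 1 -> u = v.
Proof.
move=> uv0 uv1; apply/rowP=> -[[|[|//]] ltj].
  by rewrite (_ : Ordinal ltj = 0) //; apply: val_inj.
by rewrite (_ : Ordinal ltj = 1) //; apply: val_inj.
Qed.

Lemma dot2 (R : nzRingType) (u : 'rV[R]_2) : dot u u = u 0 0 ^+ 2 + u 0 1 ^+ 2.
Proof.
rewrite /dot mxE big_ord_recl big_ord1 !mxE !expr2.
by rewrite (_ : lift ord0 ord0 = 1) //; apply: val_inj.
Qed.

Section SpecialOrthogonal.
Variables (R : realType) (n : nat).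
Implicit Types (u v w x y p q : 'rV[R]_n) (U V W M : 'M[R]_n) (a b t : R).

Lemma SOP W : W^T *m W = 1%:M -> 0 < \det W -> SO W.
Proof. by move=> WW dW; split=> //; apply: mulmx1C. Qed.

Lemma SO1 : SO (1%:M : 'M[R]_n).
Proof. by apply: SOP; rewrite ?trmx1 ?mulmx1 ?det1 ?ltr01. Qed.

Lemma SO_mul U V : SO U -> SO V -> SO (U *m V).
Proof.
case=> UU _ dU [VV _ dV]; apply: SOP; last by rewrite det_mulmx mulr_gt0.
by rewrite trmx_mul mulmxA -(mulmxA V^T) UU mulmx1.
Qed.

Lemma SO_tr U : SO U -> SO U^T.
Proof. by case=> UU UU' dU; split; rewrite ?trmxK ?det_tr. Qed.

Lemma det_SO U : SO U -> \det U = 1.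
Proof.
case=> UU _ dU; have := congr1 determinant UU.
by rewrite det_mulmx det_tr det1 => /eqP; rewrite -expr2 sqrf_eq1; lra.
Qed.

Lemma SO_mul_reflection M q : M^T *m M = 1%:M -> \det M = -1 -> q != 0 ->
  SO (M *m reflection q).
Proof.
move=> MM dM q0; apply: SOP.
  by rewrite trmx_mul tr_reflection mulmxA -(mulmxA _ M^T) MM mulmx1 reflectionK.
by rewrite det_mulmx dM det_reflection // mulrNN mulr1 ltr01.
Qed.

(** Let [c] be a point of the segment.  Up to the factor [dot q q], the vector
    [f (M *m reflection q) - c] is the value at [q] of a quadratic map into the
    plane.  Its values at [u] and [v] are opposite multiples of the direction [d]
    of the segment.  The coordinates of this quadratic map across and along [d]
    are two forms to which [common_zero] applies, and a common zero [q] gives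
    [f (M *m reflection q) = c]. *)
Lemma segment_reflections M u v t (f : 'M[R]_n -> 'rV[R]_2) :
  (3 <= n)%N -> linear f -> M^T *m M = 1%:M -> \det M = -1 ->
  u != 0 -> v != 0 -> 0 <= t <= 1 ->
  exists2 W, SO W & f W = t *: f (M *m reflection u) + (1 - t) *: f (M *m reflection v).
Proof.
move=> n3 f_lin MM dM u0 v0 /andP[t_ge0 t_le1].
set fu := f (M *m reflection u); set fv := f (M *m reflection v).
have ru := SO_mul_reflection MM dM u0; have rv := SO_mul_reflection MM dM v0.
have [->|tN0] := eqVneq t 0.
  by exists (M *m reflection v); rewrite // scale0r add0r subr0 scale1r.
have [->|tN1] := eqVneq t 1.
  by exists (M *m reflection u); rewrite // subrr scale0r addr0 scale1r.
have [fuv|fuv] := eqVneq fu fv.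
  by exists (M *m reflection u); rewrite // -fuv -scalerDl subrKC scale1r.
have fB c X Y : f (X - c *: Y) = f X - c *: f Y.
  by rewrite -scaleNr (linear_fun_addZ f_lin) scaleNr.
set pt := t *: fu + (1 - t) *: fv.
(* the polarization of the quadratic map [dot q q *: (f (M *m reflection q) - pt)] *)
pose B x y : 'rV[R]_2 := dot x y *: (f M - pt) - f (M *m (outer x y + outer y x)).
have BC x y : B x y = B y x by rewrite /B dotC (addrC (outer x y)).
have Blin a x y z : B (a *: x + y) z = a *: B x z + B y z.
  rewrite /B dotDl dotZl outerDl outerDr outerZl outerZr.
  have -> : a *: outer x z + outer y z + (a *: outer z x + outer z y)
          = a *: (outer x z + outer z x) + (outer y z + outer z y).
    by rewrite scalerDr addrACA.
  rewrite mulmxDr -scalemxAr f_lin; apply/rowP=> j; rewrite !mxE; ring.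
have Bform (c0 c1 : R) :
    symmetric_bilinear (fun x y => c0 * B x y 0 0 + c1 * B x y 0 1).
  split=> [x y|a x y z]; first by rewrite BC.
  by rewrite Blin !mxE; ring.
have BE x : x != 0 -> B x x = dot x x *: (f (M *m reflection x) - pt).
  rewrite -dot_gt0 => x0; rewrite /B /reflection.
  rewrite mulmxBr mulmx1 -scalemxAr fB mulmxDr (linear_funD f_lin).
  by apply/rowP=> j; rewrite !mxE; field; rewrite gt_eqF.
pose d := fu - fv.
have Bu : B u u = (dot u u * (1 - t)) *: d.
  by rewrite BE // -/fu /pt /d; apply/rowP=> j; rewrite !mxE; ring.
have Bv : B v v = (- (dot v v * t)) *: d.
  by rewrite BE // -/fv /pt /d; apply/rowP=> j; rewrite !mxE; ring.
have dd : 0 < d 0 0 ^+ 2 + d 0 1 ^+ 2.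
  by rewrite -dot2 dot_gt0 subr_eq0.
have uu : 0 < dot u u by rewrite dot_gt0.
have vv : 0 < dot v v by rewrite dot_gt0.
have t_gt0 : 0 < t by rewrite lt_def tN0.
have t_lt1 : 0 < 1 - t by rewrite subr_gt0 lt_def eq_sym tN1.
have [||||q q0 [gq hq]] := common_zero n3 (Bform (- d 0 1) (d 0 0))
  (Bform (d 0 0) (d 0 1)) (x := u) (y := v).
- by rewrite Bu !mxE; ring.
- by rewrite Bv !mxE; ring.
- rewrite [ltRHS](_ : _ = dot u u * (1 - t) * (d 0 0 ^+ 2 + d 0 1 ^+ 2)).
    by rewrite !mulr_gt0.
  by rewrite Bu [(_ *: d) 0 0]mxE [(_ *: d) 0 1]mxE; ring.
- rewrite [ltLHS](_ : _ = - (dot v v * t * (d 0 0 ^+ 2 + d 0 1 ^+ 2))).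
    by rewrite oppr_lt0 !mulr_gt0.
  by rewrite Bv [(_ *: d) 0 0]mxE [(_ *: d) 0 1]mxE; ring.
exists (M *m reflection q); first exact: SO_mul_reflection.
have dN0 : d 0 0 ^+ 2 + d 0 1 ^+ 2 != 0 by rewrite gt_eqF.
have B0 : B q q 0 0 = 0.
  apply: (mulfI dN0); rewrite mulr0.
  transitivity (d 0 0 * (d 0 0 * B q q 0 0 + d 0 1 * B q q 0 1)
                - d 0 1 * (- d 0 1 * B q q 0 0 + d 0 0 * B q q 0 1)); first by ring.
  by rewrite hq gq !mulr0 subrr.
have B1 : B q q 0 1 = 0.
  apply: (mulfI dN0); rewrite mulr0.
  transitivity (d 0 1 * (d 0 0 * B q q 0 0 + d 0 1 * B q q 0 1)
                + d 0 0 * (- d 0 1 * B q q 0 0 + d 0 0 * B q q 0 1)); first by ring.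
  by rewrite hq gq !mulr0 addr0.
have := BE q q0; have -> : B q q = 0.
  by apply: row2P; rewrite ?B0 ?B1 mxE.
move/esym/eqP; rewrite scaler_eq0 dot_eq0 (negPf q0) subr_eq0 => /eqP //.
Qed.

End SpecialOrthogonal.

(** * Discs of matrices in a plane *)

Definition orthonormal2 (R : nzRingType) n (x y : 'rV[R]_n) :=
  [/\ dot x x = 1, dot y y = 1 & dot x y = 0].

(** When [x], [y] is orthonormal, [1%:M + plane_part x y a b] is multiplication by
    the complex number [a + i b] on the plane of [x] and [y], and the identity on
    its orthogonal.  The part to be added to the identity is singled out because
    the parts of orthogonal planes combine by addition. *)
Definition plane_part (R : nzRingType) n (x y : 'rV[R]_n) (a b : R) : 'M[R]_n :=
  (a - 1) *: (outer x x + outer y y) + b *: (outer x y - outer y x).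

Section PlanePart.
Variables (R : realType) (n : nat).
Implicit Types (u v w x y p q : 'rV[R]_n) (U V W M : 'M[R]_n) (a b c s t : R).

Lemma mulmx_plane_part v x y a b : v *m plane_part x y a b =
  ((a - 1) * dot v x - b * dot v y) *: x + ((a - 1) * dot v y + b * dot v x) *: y.
Proof.
rewrite /plane_part mulmxDr -!scalemxAr mulmxDr mulmxBr !mulmx_outer.
by apply/rowP=> j; rewrite !mxE; ring.
Qed.

Lemma mulmx_plane_part0 v x y a b :
  dot v x = 0 -> dot v y = 0 -> v *m plane_part x y a b = 0.
Proof.
by move=> vx vy; rewrite mulmx_plane_part vx vy !mulr0 subrr addr0 !scale0r addr0.
Qed.

Lemma mulmx_plane_partl W x y a b : x *m W^T = x -> y *m W^T = y ->
  W *m plane_part x y a b = plane_part x y a b.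
Proof.
move=> Wx Wy; rewrite /plane_part mulmxDr -!scalemxAr mulmxDr mulmxBr.
by rewrite !mulmx_outerl Wx Wy.
Qed.

Lemma fixed_tr W v : SO W -> v *m W = v -> v *m W^T = v.
Proof. by case=> _ WW _ vW; rewrite -[in LHS]vW -mulmxA WW mulmx1. Qed.

Lemma mulmx_plane_rotation W x y a b : SO W -> x *m W = x -> y *m W = y ->
  W *m (1%:M + plane_part x y a b) = W + plane_part x y a b.
Proof.
by move=> sW xW yW; rewrite mulmxDr mulmx1 mulmx_plane_partl // fixed_tr.
Qed.

Lemma half_angle a b : a ^+ 2 + b ^+ 2 = 1 ->
  exists c s, [/\ c ^+ 2 + s ^+ 2 = 1, a = c ^+ 2 - s ^+ 2 & b = 2 * c * s].
Proof.
move=> ab1; have a_le1 : a <= 1 by have := sqr_ge0 b; nra.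
have a_geN1 : -1 <= a by have := sqr_ge0 b; nra.
have [c cc] : exists c, c ^+ 2 = (1 + a) / 2.
  by exists (Num.sqrt ((1 + a) / 2)); rewrite sqr_sqrtr //; lra.
have [s ss] : exists s, s ^+ 2 = (1 - a) / 2.
  by exists (Num.sqrt ((1 - a) / 2)); rewrite sqr_sqrtr //; lra.
have : (b - 2 * c * s) * (b + 2 * c * s) = 0.
  by rewrite -subr_sqr !exprMn cc ss; lra.
move/eqP; rewrite mulf_eq0 => /orP[|]; rewrite ?subr_eq0 ?addr_eq0 => /eqP bE.
  by exists c, s; split=> //; rewrite cc ss; lra.
by exists c, (- s); rewrite sqrrN mulrN; split=> //; rewrite cc ss; lra.
Qed.

(** A plane rotation is a product of two reflections whose axes make half of its
    angle. *)
Lemma plane_rotation_reflections x y a b :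
  orthonormal2 x y -> a ^+ 2 + b ^+ 2 = 1 ->
  exists2 q, q != 0 &
    1%:M + plane_part x y a b = reflection x *m reflection q.
Proof.
case=> xx yy xy /half_angle[c [s [cs -> ->]]].
have qq : dot (c *: x + s *: y) (c *: x + s *: y) = 1.
  by rewrite !(dotDl, dotDr, dotZl, dotZr) (dotC y x) xx yy xy -[RHS]cs; ring.
exists (c *: x + s *: y); first by rewrite -dot_gt0 qq.
rewrite /reflection qq xx divr1 mulmxBl !mul1mx mulmxBr mulmx1.
rewrite -scalemxAl -!scalemxAr !outer_mulmx mulmx_outer.
rewrite dotDr !dotZr xx xy mulr0 addr0 mulr1.
rewrite !(outerDl, outerDr, outerZl, outerZr) /plane_part.
move: (outer x x) (outer x y) (outer y x) (outer y y) => Pxx Pxy Pyx Pyy.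
apply/matrixP=> i j; rewrite !mxE.
have := congr1 (fun z => (Pyy i j - Pxx i j) * z) cs; rewrite /=; lra.
Qed.

Lemma SO_plane_rotation x y a b :
  orthonormal2 x y -> a ^+ 2 + b ^+ 2 = 1 -> SO (1%:M + plane_part x y a b).
Proof.
move=> oxy ab1; have [q q0 ->] := plane_rotation_reflections oxy ab1.
have x0 : x != 0 by rewrite -dot_gt0 (let: And3 xx _ _ := oxy in xx) ltr01.
apply: SO_mul_reflection => //; last exact: det_reflection.
by rewrite tr_reflection reflectionK.
Qed.

Lemma SO_plane_part W x y a b : SO W -> orthonormal2 x y ->
  x *m W = x -> y *m W = y -> a ^+ 2 + b ^+ 2 = 1 ->
  SO (W + plane_part x y a b).
Proof.
move=> sW oxy xW yW ab1; rewrite -mulmx_plane_rotation //.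
exact/SO_mul/SO_plane_rotation.
Qed.

(** A point of the disc is on a chord joining the two points of the circle with the
    same abscissa [a]; these correspond to two rotations that differ from a common
    [M] by a reflection, so [segment_reflections] applies. *)
Lemma disc_image W x y a b (f : 'M[R]_n -> 'rV[R]_2) :
  (3 <= n)%N -> linear f -> SO W -> orthonormal2 x y ->
  x *m W = x -> y *m W = y -> a ^+ 2 + b ^+ 2 <= 1 ->
  exists2 W', SO W' & f W' = f (W + plane_part x y a b).
Proof.
move=> n3 f_lin sW oxy xW yW ab1.
have x0 : x != 0 by rewrite -dot_gt0 (let: And3 xx _ _ := oxy in xx) ltr01.
pose r := Num.sqrt (1 - a ^+ 2).
have r_ge0 : 0 <= r by apply: sqrtr_ge0.
have rr : r ^+ 2 = 1 - a ^+ 2 by rewrite sqr_sqrtr //; have := sqr_ge0 b; lra.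
have /ler_wsqrtr : b ^+ 2 <= 1 - a ^+ 2 by lra.
rewrite sqrtr_sqr -/r ler_norml => /andP[b_ge b_le].
have [t t01 bE] : exists2 t, 0 <= t <= 1 & b = t * r + (1 - t) * - r.
  have [r0|rN0] := eqVneq r 0.
    by exists 0; [rewrite lexx ler01 | rewrite r0 in b_le b_ge *; lra].
  have r_gt0 : 0 < r by rewrite lt_def rN0.
  exists ((r + b) / (2 * r)); last by field.
  rewrite divr_ge0 ?ler_pdivrMr /=; lra.
have [|u u0 uE] := plane_rotation_reflections (a := a) (b := r) oxy.
  by rewrite rr; ring.
have [|v v0 vE] := plane_rotation_reflections (a := a) (b := - r) oxy.
  by rewrite sqrrN rr; ring.
have [||W' sW' fW'] := @segment_reflections _ _ (W *m reflection x) u v t f n3 f_lin _ _ u0 v0 t01.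
- have [WW _ _] := sW; rewrite trmx_mul tr_reflection mulmxA -(mulmxA _ W^T) WW.
  by rewrite mulmx1 reflectionK.
- by rewrite det_mulmx (det_SO sW) det_reflection // mul1r.
exists W' => //; rewrite fW' -!mulmxA -uE -vE !mulmx_plane_rotation //.
rewrite -(linear_funZ f_lin (1 - t)) -f_lin; congr f; rewrite /plane_part bE; move: (outer x x + _) (outer x y - _) => P Q.
by apply/matrixP=> i j; rewrite !mxE; ring.
Qed.
End PlanePart.

(** * Planes turned by a rotation *)

Section ComplexEigenvector.
Import complex.
Local Open Scope complex_scope.

(** [x] and [y] are the real and imaginary parts of a complex eigenvector, for the
    eigenvalue [a + i b]. *)
Lemma real_invariant_pair (R : rcfType) r (C : 'M[R]_r) : (0 < r)%N ->
  exists (x y : 'rV[R]_r) (a b : R), [/\ (x != 0) || (y != 0),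
    x *m C = a *: x - b *: y & y *m C = b *: x + a *: y].
Proof.
move=> r_gt0; pose toC := real_complex R : R -> R[i].
have [l /eigenvalueP[w wC w_neq0]] := eigenvalue_closed (map_mx toC C) r_gt0.
exists (map_mx (@Re R) w), (map_mx (@Im R) w), (Re l), (Im l); split.
- apply: contra_neqT w_neq0; rewrite negb_or !negbK => /andP[/eqP x0 /eqP y0].
  apply/rowP=> j; have := congr1 (fun v : 'rV[R]_r => v 0 j) x0.
  have := congr1 (fun v : 'rV[R]_r => v 0 j) y0.
  by rewrite !mxE; case: (w 0 j) => u v /= -> ->.
- apply/rowP=> j; have := congr1 (fun v : 'rV[R[i]]_r => Re (v 0 j)) wC.
  rewrite !mxE raddf_sum /=; case: l {wC} (w 0 j) => la lb [wa wb] /= <-.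
  by apply: eq_bigr => k _; rewrite !mxE; case: (w 0 k) => u v /=; rewrite mulr0 subr0.
- apply/rowP=> j; have := congr1 (fun v : 'rV[R[i]]_r => Im (v 0 j)) wC.
  rewrite !mxE raddf_sum /=; case: l {wC} (w 0 j) => la lb [wa wb] /=.
  rewrite addrC => <-.
  by apply: eq_bigr => k _; rewrite !mxE; case: (w 0 k) => u v /=; rewrite mulr0 add0r.
Qed.
End ComplexEigenvector.

Section NormalForm.
Variables (R : realType) (n : nat).
Implicit Types (u v w x y p q : 'rV[R]_n) (U V W M : 'M[R]_n) (a b c s t : R).

Lemma dot_mulmx V u v : V *m V^T = 1%:M -> dot (u *m V) (v *m V) = dot u v.
Proof. by move=> VV; rewrite dot_mull -mulmxA VV mulmx1. Qed.

(** For an orthogonal [V], the range of [V - 1] is orthogonal to the vectors fixed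
    by [V]. *)
Lemma fixed_in_range V v : V *m V^T = 1%:M ->
  (v <= V - 1%:M)%MS -> v *m V = v -> v = 0.
Proof.
move=> VV /submxP[w vE] vV; apply/eqP; rewrite -dot_eq0 {1}vE dot_mull.
have -> : v *m (V - 1%:M)^T = 0.
  rewrite linearB /= trmx1 mulmxBr mulmx1 -[in X in X - _]vV.
  by rewrite -mulmxA VV mulmx1 subrr.
by rewrite dotC dot0l.
Qed.

(** Restricting [V] to the range of [V - 1] before looking for an eigenvector
    excludes the eigenvalue [1]. *)
Lemma invariant_pair V : V *m V^T = 1%:M -> V != 1%:M ->
  exists x y a b, [/\ (x != 0) || (y != 0),
    x *m V = a *: x - b *: y, y *m V = b *: x + a *: y &
    (x <= V - 1%:M)%MS /\ (y <= V - 1%:M)%MS].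
Proof.
move=> VV V_neq1; set D := V - 1%:M; pose B := row_base D.
have BV : (B *m V <= B)%MS.
  rewrite eq_row_base (submx_trans (submxMr V (_ : B <= D)%MS)) ?eq_row_base //.
  have -> : D *m V = V *m D by rewrite mulmxBl mulmxBr mul1mx mulmx1.
  exact: submxMl.
have r_gt0 : (0 < \rank D)%N by rewrite lt0n mxrank_eq0 subr_eq0.
have [x [y [a [b [xy0 xC yC]]]]] := real_invariant_pair (B *m V *m pinvmx B) r_gt0.
have CB (z : 'rV_(\rank D)) : z *m (B *m V *m pinvmx B) *m B = z *m B *m V.
  by rewrite -mulmxA mulmxKpV // mulmxA.
exists (x *m B), (y *m B), a, b; split.
- by rewrite !mulmx_free_eq0 ?row_base_free.
- by rewrite -CB xC mulmxBl -!scalemxAl.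
- by rewrite -CB yC mulmxDl -!scalemxAl.
- by split; rewrite -(eq_row_base D) submxMl.
Qed.

(** [M + 1 = M (M + 1)^T] for an orthogonal [M], so that its determinant is its own
    opposite. *)
Lemma orthogonal_eigenvectorN1 M : M *m M^T = 1%:M -> \det M = -1 ->
  exists2 u : 'rV[R]_n, u != 0 & u *m M = - u.
Proof.
move=> MM dM; have /eqP/det0P[u u0 uM] : \det (M + 1%:M) = 0.
  have : \det (M + 1%:M) = \det M * \det (M + 1%:M).
    rewrite -[in RHS](det_tr (M + _)) -det_mulmx linearD /= trmx1.
    by rewrite mulmxDr MM mulmx1 addrC.
  rewrite dM; lra.
by exists u => //; apply/eqP; rewrite -addr_eq0 -[X in _ + X]mulmx1 -mulmxDr uM.
Qed.

Definition normalize v := (Num.sqrt (dot v v))^-1 *: v.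

Lemma dot_normalize v : v != 0 -> dot (normalize v) (normalize v) = 1.
Proof.
rewrite -dot_gt0 => vv; rewrite /normalize dotZl dotZr mulrA -invfM -expr2.
by rewrite sqr_sqrtr ?ltW // mulVf // gt_eqF.
Qed.

(** The eigenvalue [-1] of a rotation has a second eigenvector, because composing
    the rotation with the reflection along the first one leaves an orthogonal
    matrix of determinant [-1]. *)
Lemma half_turn_plane V v : SO V -> v != 0 -> v *m V = - v ->
  exists x y, [/\ orthonormal2 x y, x *m V = - x & y *m V = - y].
Proof.
move=> sV v0 vV; have [_ VV _] := sV.
have [||u u0 uM] := @orthogonal_eigenvectorN1 (reflection v *m V).
- by rewrite trmx_mul tr_reflection mulmxA -(mulmxA _ V) VV mulmx1 reflectionK.
- by rewrite det_mulmx det_reflection // (det_SO sV) mulr1.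
have vR : v *m reflection v = - v.
  rewrite /reflection mulmxBr mulmx1 -scalemxAr mulmx_outer scalerA divfK ?dot_eq0 //.
  by rewrite scaler_nat mulr2n opprD addrA subrr sub0r.
have vu : dot v u = 0.
  have MM : (reflection v *m V) *m (reflection v *m V)^T = 1%:M.
    by rewrite trmx_mul tr_reflection mulmxA -(mulmxA _ V) VV mulmx1 reflectionK.
  have := dot_mulmx v u MM; rewrite uM mulmxA vR mulNmx vV opprK.
  rewrite -scaleN1r dotZr; lra.
have uV : u *m V = - u.
  rewrite -[RHS]uM mulmxA; congr (_ *m _).
  by rewrite /reflection mulmxBr mulmx1 -scalemxAr mulmx_outer dotC vu scale0r scaler0 subr0.
exists (normalize v), (normalize u); split.
- by split; rewrite ?dot_normalize // /normalize dotZl dotZr vu !mulr0.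
- by rewrite -scalemxAl vV scalerN.
- by rewrite -scalemxAl uV scalerN.
Qed.

(** A real eigenvalue other than [1] is [-1] and comes with a half turn.  For a
    complex one, invariance of the scalar product forces the real and imaginary
    parts of the eigenvector to be orthogonal and of equal length. *)
Lemma rotated_plane V : SO V -> V != 1%:M ->
  exists x y a b, [/\ orthonormal2 x y, a ^+ 2 + b ^+ 2 = 1, a != 1,
    x *m V = a *: x + b *: y & y *m V = a *: y - b *: x].
Proof.
move=> sV V_neq1; have [_ VV _] := sV.
have eig v a : v != 0 -> v *m V = a *: v -> (v <= V - 1%:M)%MS ->
    exists x y a b, [/\ orthonormal2 x y, a ^+ 2 + b ^+ 2 = 1, a != 1,
      x *m V = a *: x + b *: y & y *m V = a *: y - b *: x].
  move=> v0 vV vD; have vv : dot v v != 0 by rewrite dot_eq0.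
  have /eqP : a ^+ 2 = 1.
    apply: (mulIf vv); rewrite mul1r -[RHS](dot_mulmx _ _ VV) vV dotZl dotZr.
    by rewrite mulrA.
  rewrite sqrf_eq1 => /orP[] /eqP aE.
    by rewrite aE scale1r in vV; rewrite (fixed_in_range VV vD vV) eqxx in v0.
  rewrite aE scaleN1r in vV.
  have [x [y [oxy xV yV]]] := half_turn_plane sV v0 vV.
  exists x, y, (-1), 0; split; rewrite ?scale0r ?addr0 ?subr0 ?scaleN1r //.
    by rewrite sqrrN expr1n expr0n addr0.
  by rewrite lt_eqF //; lra.
have [x [y [a [b [xy0 xV yV [xD yD]]]]]] := invariant_pair VV V_neq1.
have [b0|bN0] := eqVneq b 0.
  rewrite b0 !scale0r ?subr0 ?add0r in xV yV.
  by case/orP: xy0 => z0; [apply: (eig x a) | apply: (eig y a)].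
have exx := dot_mulmx x x VV; have exy := dot_mulmx x y VV.
have eyy := dot_mulmx y y VV.
rewrite xV yV -!scaleNr !(dotDl, dotDr, dotZl, dotZr) (dotC y x) in exx exy eyy.
have pos : 0 < dot x x + dot y y.
  by case/orP: xy0; rewrite -dot_gt0 => z0; [rewrite ltr_pwDl ?dot_ge0 | rewrite ltr_pwDr ?dot_ge0].
have ab1 : a ^+ 2 + b ^+ 2 = 1.
  by apply: (mulIf (lt0r_neq0 pos)); lra.
have abX := congr1 (fun z => z * dot x x) ab1.
have abY := congr1 (fun z => z * dot y y) ab1.
have abP := congr1 (fun z => z * dot x y) ab1.
rewrite /= in abX abY abP.
(* With [N = |x|^2 - |y|^2] and [P = <x, y>], invariance of the scalar product
   reads [b N = - 2 a P] and [a N = 2 b P]; as [a^2 + b^2 = 1], both vanish. *)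
have bN : b * (dot x x - dot y y) = - (2 * a * dot x y) by apply: (mulfI bN0); lra.
have aN : a * (dot x x - dot y y) = 2 * b * dot x y by apply: (mulfI bN0); lra.
have xxyy : dot x x = dot y y.
  have := congr1 (fun z => a * z) aN; have := congr1 (fun z => b * z) bN.
  rewrite /=; lra.
have xy : dot x y = 0.
  rewrite xxyy subrr !mulr0 in aN bN.
  have := congr1 (fun z => a * z) bN; have := congr1 (fun z => b * z) aN.
  rewrite /=; lra.
have yy_gt0 : 0 < dot y y by lra.
have x0 : x != 0 by rewrite -dot_gt0 xxyy.
have y0 : y != 0 by rewrite -dot_gt0.
exists (normalize x), (- normalize y), a, b; split=> //.
- split; rewrite ?dot_normalize //.
    by rewrite -scaleN1r dotZl dotZr dot_normalize //; lra.
  by rewrite -scaleN1r dotZr /normalize dotZl dotZr xy !mulr0.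
- apply: contra_neq bN0 => a1; move: ab1; rewrite a1 expr1n => /eqP.
  by rewrite -subr_eq0 addrC addKr sqrf_eq0 => /eqP.
- rewrite /normalize -scalemxAl xV xxyy.
  by apply/rowP=> j; rewrite !mxE; ring.
- rewrite /normalize mulNmx -scalemxAl yV xxyy.
  by apply/rowP=> j; rewrite !mxE; ring.
Qed.
End NormalForm.

(** * Reduction of a segment of rotations to a disc *)

Section Reduction.
Variables (R : realType) (n : nat).
Implicit Types (u v w x y p q : 'rV[R]_n) (U V W M : 'M[R]_n) (a b c s t : R).

(** Undoing the rotation of [V] in one plane leaves a rotation [V'] that fixes this
    plane in addition to what [V] fixes; the rank of [V - 1] drops, which makes
    it the measure of the induction in [segment_to_disc]. *)
Lemma split_rotation V x y a b : SO V -> orthonormal2 x y ->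
  a ^+ 2 + b ^+ 2 = 1 -> a != 1 ->
  x *m V = a *: x + b *: y -> y *m V = a *: y - b *: x ->
  let V' := V - plane_part x y a b in
  [/\ SO V', x *m V' = x /\ y *m V' = y,
      forall v, v *m V = v -> [/\ v *m V' = v, dot v x = 0 & dot v y = 0]
    & (\rank (V' - 1%:M)%R < \rank (V - 1%:M)%R)%N].
Proof.
move=> sV oxy ab1 a_neq1 xV yV V'; have [xx yy xy] := oxy.
have yx : dot y x = 0 by rewrite dotC.
have [_ VV _] := sV.
have xE : x = a *: (x *m V^T) + b *: (y *m V^T).
  by rewrite !scalemxAl -mulmxDl -xV -mulmxA VV mulmx1.
have yE : y = a *: (y *m V^T) - b *: (x *m V^T).
  by rewrite !scalemxAl -mulmxBl -yV -mulmxA VV mulmx1.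
have [xVt yVt] : x *m V^T = a *: x - b *: y /\ y *m V^T = b *: x + a *: y.
  move: (x *m V^T) (y *m V^T) xE yE => X Y xE yE; rewrite xE yE.
  by split; apply/rowP=> j; rewrite !mxE -[LHS]mul1r -[in LHS]ab1; ring.
have V'E : V' = V *m (1%:M + plane_part x y a (- b)).
  rewrite mulmxDr mulmx1; congr (V + _); rewrite /plane_part mulmxDr -!scalemxAr.
  rewrite mulmxDr mulmxBr !mulmx_outerl xVt yVt -!scaleNr !(outerDl, outerZl).
  move: (outer x x) (outer x y) (outer y x) (outer y y) => Pxx Pxy Pyx Pyy.
  apply/matrixP=> i j; rewrite !mxE.
  have hx := congr1 (fun z => z * Pxx i j) ab1.
  have hy := congr1 (fun z => z * Pyy i j) ab1.
  have hxy := congr1 (fun z => z * Pxy i j) ab1.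
  have hyx := congr1 (fun z => z * Pyx i j) ab1.
  rewrite /= in hx hy hxy hyx; lra.
have xV' : x *m V' = x.
  rewrite mulmxBr xV mulmx_plane_part xx xy.
  by apply/rowP=> j; rewrite !mxE; ring.
have yV' : y *m V' = y.
  rewrite mulmxBr yV mulmx_plane_part yy yx.
  by apply/rowP=> j; rewrite !mxE; ring.
have K0 : 2 * (1 - a) != 0.
  by rewrite mulf_neq0 ?pnatr_eq0 // subr_eq0 eq_sym.
have fixV v : v *m V = v -> [/\ v *m V' = v, dot v x = 0 & dot v y = 0].
  move=> vV; have hx := dot_mulmx v x VV; have hy := dot_mulmx v y VV.
  rewrite vV xV yV -scaleNr !(dotDr, dotZr) in hx hy.
  have hx1 := congr1 (fun z => z * dot v x) ab1.
  have hy1 := congr1 (fun z => z * dot v y) ab1.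
  have ahx := congr1 (fun z => a * z) hx; have bhx := congr1 (fun z => b * z) hx.
  have ahy := congr1 (fun z => a * z) hy; have bhy := congr1 (fun z => b * z) hy.
  rewrite /= in hx1 hy1 ahx bhx ahy bhy.
  have vx : dot v x = 0 by apply: (mulfI K0); lra.
  have vy : dot v y = 0 by apply: (mulfI K0); lra.
  by split=> //; rewrite mulmxBr vV mulmx_plane_part0 // subr0.
have sV' : SO V'.
  rewrite V'E; apply: SO_mul => //; apply: SO_plane_rotation => //.
  by rewrite sqrrN.
split=> //.
(* [V' - 1] is [V - 1] composed with the projection orthogonal to the plane *)
have sub : (V' - 1%:M <= V - 1%:M)%MS.
  apply/submxP; exists (1%:M - outer x x - outer y y).
  have -> : V - 1%:M = (V' - 1%:M) + plane_part x y a b by rewrite /V' addrAC subrK.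
  have h0 z : z *m V' = z -> outer z z *m (V' - 1%:M) = 0.
    by move=> zV'; rewrite outer_mulmx mulmxBr zV' mulmx1 subrr /outer mulmx0.
  rewrite mulmxDr !mulmxBl !mul1mx !h0 // !subr0 /plane_part !mulmxDr -!scalemxAr.
  rewrite !mulmxDr !mulmxN !outer_mulmx !mulmx_outer xx yy xy yx !scale1r !scale0r.
  rewrite /outer !mulmx0.
  by apply/matrixP=> i j; rewrite !mxE; ring.
apply: rank_ltmx; rewrite ltmxE sub /=; apply/negP=> sub'.
have xD : (x <= V - 1%:M)%MS.
  apply/submxP; exists ((2 * (1 - a))^-1 *: ((a - 1) *: x - b *: y)).
  rewrite -scalemxAl; apply: (scalerI K0); rewrite scalerA divff // scale1r.
  rewrite mulmxBr mulmx1 mulmxBl -!scalemxAl xV yV.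
  apply/rowP=> j; rewrite !mxE.
  by have := congr1 (fun z => z * x 0 j) ab1; rewrite /=; lra.
have [_ VV' _] := sV'.
have x0 := fixed_in_range VV' (submx_trans xD sub') xV'.
by move: xx; rewrite x0 dot0l => /eqP; rewrite eq_sym oner_eq0.
Qed.

(** Along a ray from a point of the disc, the squared norm is a convex quadratic
    function, whose larger crossing of the value [1] is the exit time [s]. *)
Lemma circle_exit (a b u v : R) : a ^+ 2 + b ^+ 2 <= 1 -> (u != 0) || (v != 0) ->
  exists2 s, 0 <= s & (a + s * u) ^+ 2 + (b + s * v) ^+ 2 = 1 /\
    forall t, 0 <= t <= s -> (a + t * u) ^+ 2 + (b + t * v) ^+ 2 <= 1.
Proof.
move=> ab1 uv0; pose K := u ^+ 2 + v ^+ 2; pose B := a * u + b * v.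
have K_gt0 : 0 < K.
  rewrite lt_def addr_ge0 ?sqr_ge0 // andbT paddr_eq0 ?sqr_ge0 // !sqrf_eq0.
  by rewrite negb_and.
have D_ge0 : 0 <= K * (1 - (a ^+ 2 + b ^+ 2)) by rewrite mulr_ge0 ?subr_ge0 // ltW.
have [r r_ge0 rr] : exists2 r, 0 <= r & r ^+ 2 = B ^+ 2 + K * (1 - (a ^+ 2 + b ^+ 2)).
  exists (Num.sqrt (B ^+ 2 + K * (1 - (a ^+ 2 + b ^+ 2)))); first exact: sqrtr_ge0.
  by rewrite sqr_sqrtr // addr_ge0 ?sqr_ge0.
have : `|B| <= r.
  by rewrite -[r]ger0_norm // -!sqrtr_sqr ler_wsqrtr // rr lerDl.
rewrite ler_norml => /andP[B_ge B_le].
have E t : K * ((a + t * u) ^+ 2 + (b + t * v) ^+ 2 - 1) = (K * t + B) ^+ 2 - r ^+ 2.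
  by rewrite rr /K /B; ring.
have Ks : K * ((r - B) / K) = r - B by rewrite mulrC divfK // gt_eqF.
exists ((r - B) / K); first by rewrite divr_ge0 ?subr_ge0 // ltW.
split.
  apply/eqP; rewrite -subr_eq0; apply/eqP/(mulfI (lt0r_neq0 K_gt0)).
  by rewrite E Ks mulr0 subrK subrr.
move=> t /andP[t_ge0 ts]; rewrite -subr_le0 -(pmulr_rle0 _ K_gt0) E subr_le0.
have Kt : 0 <= K * t by rewrite mulr_ge0 // ltW.
have Kt_le : K * t <= r - B by rewrite -Ks ler_pM2l.
nra.
Qed.

(** The four coordinates of the two points have a nonzero direction along which the
    image in the plane is constant; follow it until the first of the two points
    leaves its disc. *)
Lemma slide_to_circle (P Q P' Q' : 'rV[R]_2) a b c d :
  a ^+ 2 + b ^+ 2 <= 1 -> c ^+ 2 + d ^+ 2 <= 1 ->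
  exists a' b' c' d',
    [/\ a' ^+ 2 + b' ^+ 2 <= 1, c' ^+ 2 + d' ^+ 2 <= 1,
        (a' ^+ 2 + b' ^+ 2 = 1) \/ (c' ^+ 2 + d' ^+ 2 = 1)
      & a' *: P + b' *: Q + c' *: P' + d' *: Q'
        = a *: P + b *: Q + c *: P' + d *: Q'].
Proof.
move=> ab1 cd1.
pose phi (z : 'rV[R]_4) := z 0 0 *: P + z 0 1 *: Q + z 0 2 *: P' + z 0 3 *: Q'.
have phi_lin : linear phi.
  by move=> k z z'; rewrite /phi; apply/rowP=> j; rewrite !mxE; ring.
have [z z0 phiz] := exists_kernel_vector (isT : (2 < 4)%N) phi_lin.
have slideE s : (a + s * z 0 0) *: P + (b + s * z 0 1) *: Q
    + (c + s * z 0 2) *: P' + (d + s * z 0 3) *: Q'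
  = a *: P + b *: Q + c *: P' + d *: Q'.
  rewrite -[RHS]addr0 -[X in _ = _ + X](scaler0 _ s) -phiz /phi.
  by apply/rowP=> j; rewrite !mxE; ring.
have znz : [|| z 0 0 != 0, z 0 1 != 0, z 0 2 != 0 | z 0 3 != 0].
  apply: contraNT z0; rewrite !negb_or !negbK => /and4P[/eqP e0 /eqP e1 /eqP e2 /eqP e3].
  apply/eqP/rowP=> -[[|[|[|[|//]]]] ltj]; rewrite mxE.
  - by rewrite (_ : Ordinal ltj = 0) //; apply: val_inj.
  - by rewrite (_ : Ordinal ltj = 1) //; apply: val_inj.
  - by rewrite (_ : Ordinal ltj = 2) //; apply: val_inj.
  - by rewrite (_ : Ordinal ltj = 3) //; apply: val_inj.
have [u0|] := boolP ((z 0 0 != 0) || (z 0 1 != 0)); last first.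
  rewrite negb_or !negbK => /andP[/eqP e0 /eqP e1].
  rewrite e0 e1 !eqxx /= in znz.
  have [s s0 [s1 _]] := circle_exit cd1 znz.
  exists (a + s * z 0 0), (b + s * z 0 1), (c + s * z 0 2), (d + s * z 0 3).
  rewrite slideE s1 e0 e1 !mulr0 !addr0; split=> //; by right.
have [s s0 [s1 sle]] := circle_exit ab1 u0.
have [v0|] := boolP ((z 0 2 != 0) || (z 0 3 != 0)); last first.
  rewrite negb_or !negbK => /andP[/eqP e2 /eqP e3].
  exists (a + s * z 0 0), (b + s * z 0 1), (c + s * z 0 2), (d + s * z 0 3).
  rewrite slideE s1 e2 e3 !mulr0 !addr0; split=> //; by left.
have [t t0 [t1 tle]] := circle_exit cd1 v0.
have [st|ts] := leP s t.
  exists (a + s * z 0 0), (b + s * z 0 1), (c + s * z 0 2), (d + s * z 0 3).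
  by rewrite slideE s1 tle ?s0 //; split=> //; left.
exists (a + t * z 0 0), (b + t * z 0 1), (c + t * z 0 2), (d + t * z 0 3).
by rewrite slideE t1 (sle t) ?t0 ?(ltW ts) //; split=> //; right.
Qed.

(** Induction on the rank of [V - 1]: split off one plane, apply the induction
    hypothesis to the remaining rotation, and slide the two discs that result
    until one of them can be absorbed into [W].  The clause on the vectors fixed
    by [V] carries through the induction that the new disc and the plane split
    off are orthogonal. *)
Lemma segment_to_disc (f : 'M[R]_n -> 'rV[R]_2) V t : linear f ->
  SO V -> V != 1%:M -> 0 <= t <= 1 ->
  exists W p q a b,
  [/\ [/\ SO W, orthonormal2 p q, p *m W = p & q *m W = q],
      a ^+ 2 + b ^+ 2 <= 1,
      forall v, v *m V = v -> [/\ v *m W = v, dot v p = 0 & dot v q = 0]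
    & f (W + plane_part p q a b) = f (1%:M + t *: (V - 1%:M))].
Proof.
move=> f_lin; have [k] := ubnP (\rank (V - 1%:M)); elim: k V => // k IH V.
rewrite ltnS => rk sV V_neq1 /[dup] t01 /andP[t_ge0 t_le1].
have [x [y [a [b [oxy ab1 a_neq1 xV yV]]]]] := rotated_plane sV V_neq1.
set V' := V - plane_part x y a b.
have [sV' [xV' yV'] fixV rk'] := split_rotation sV oxy ab1 a_neq1 xV yV.
rewrite -/V' in sV' xV' yV' fixV rk'.
pose a1 := 1 + t * (a - 1); pose b1 := t * b.
have disc1 : a1 ^+ 2 + b1 ^+ 2 <= 1.
  have -> : a1 ^+ 2 + b1 ^+ 2 = 1 - 2 * (t * (1 - t) * (1 - a))
      + t ^+ 2 * (a ^+ 2 + b ^+ 2 - 1) by rewrite /a1 /b1; ring.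
  rewrite ab1 subrr mulr0 addr0 gerBl mulr_ge0 ?ler0n //.
  rewrite !mulr_ge0 ?subr_ge0 //; have := sqr_ge0 b; nra.
(* the point [a1 + i b1] of the disc is [1 + t ((a + i b) - 1)] *)
have XE : 1%:M + t *: (V - 1%:M)
    = 1%:M + t *: (V' - 1%:M) + plane_part x y a1 b1.
  rewrite /V' /plane_part /a1 /b1.
  move: (outer x x + _) (outer x y - _) => P Q.
  by apply/matrixP=> i j; rewrite !mxE; ring.
have [V'1|V'_neq1] := eqVneq V' 1%:M.
  exists 1%:M, x, y, a1, b1; rewrite !mulmx1; split=> //; first by split=> //; exact: SO1.
    by move=> v /fixV[_ vx vy]; rewrite mulmx1.
  by rewrite XE V'1 subrr scaler0 addr0.
have [W [p [q [c [d [[sW opq pW qW] cd1 fixW fE]]]]]] :=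
  IH V' (leq_trans rk' rk) sV' V'_neq1 t01.
have [xW xp xq] := fixW x xV'; have [yW yp yq] := fixW y yV'.
set P := outer x x + outer y y; set Q := outer x y - outer y x.
set P' := outer p p + outer q q; set Q' := outer p q - outer q p.
have [a' [b' [c' [d' [ab1' cd1' circ slide]]]]] :=
  slide_to_circle (f P) (f Q) (f P') (f Q') disc1 cd1.
have fE' : f (W + plane_part x y a' b' + plane_part p q c' d')
    = f (1%:M + t *: (V - 1%:M)).
  have fD := linear_funD f_lin.
  rewrite XE fD (fD _ (plane_part x y a1 b1)) -fE !fD /plane_part -/P -/Q -/P' -/Q'.
  rewrite ?fD !(linear_funZ f_lin); apply/rowP=> j; have /rowP/(_ j) := slide; rewrite !mxE; lra.
case: circ => circ.
  exists (W + plane_part x y a' b'), p, q, c', d'; split=> //.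
    split=> //; first exact: SO_plane_part.
      by rewrite mulmxDr pW mulmx_plane_part0 ?addr0 // dotC.
    by rewrite mulmxDr qW mulmx_plane_part0 ?addr0 // dotC.
  move=> v /fixV[vV' vx vy]; have [vW vp vq] := fixW v vV'.
  by rewrite mulmxDr vW mulmx_plane_part0 ?addr0.
exists (W + plane_part p q c' d'), x, y, a', b'; split=> //.
- split=> //; first exact: SO_plane_part.
    by rewrite mulmxDr xW mulmx_plane_part0 ?addr0.
  by rewrite mulmxDr yW mulmx_plane_part0 ?addr0.
- move=> v /fixV[vV' vx vy]; have [vW vp vq] := fixW v vV'.
  by rewrite mulmxDr vW mulmx_plane_part0 ?addr0.
- by rewrite addrAC.
Qed.

Lemma linear_image_SO_convex (f : 'M[R]_n -> 'rV[R]_2) : (3 <= n)%N ->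
  linear f -> convex_set (f @` @SO R n).
Proof.
move=> n3 f_lin _ _ k /set_mem[U sU <-] /set_mem[V sV <-]; apply/mem_set.
pose t : R := 1 - k%:num.
have t01 : 0 <= t <= 1.
  by rewrite /t subr_ge0 gerBl; apply/andP; split.
have [UU UU' _] := sU.
pose g X := f (U *m X).
have g_lin : linear g.
  by move=> c X Y; rewrite /g mulmxDr -scalemxAr f_lin.
have -> : conv k (f U : convex_lmodType 'rV[R]_2) (f V)
        = g (1%:M + t *: (U^T *m V - 1%:M)).
  transitivity (k%:num *: f U + t *: f V); first by [].
  rewrite /g mulmxDr -scalemxAr mulmxBr mulmxA UU' mul1mx mulmx1.
  rewrite (linear_fun_addZ f_lin) -[- U]scaleN1r (linear_fun_addZ f_lin) scaleN1r.
  by apply/rowP=> j; rewrite !mxE /t; ring.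
have [UV1|UV_neq1] := eqVneq (U^T *m V) 1%:M.
  by exists U; rewrite // UV1 subrr scaler0 addr0 /g mulmx1.
have sUV := SO_mul (SO_tr sU) sV.
have [W [p [q [a [b [[sW opq pW qW] ab1 _ <-]]]]]] := segment_to_disc g_lin sUV UV_neq1 t01.
have [W' sW' <-] := disc_image n3 g_lin sW opq pW qW ab1.
by exists (U *m W') => //; exact: SO_mul.
Qed.
End Reduction.

Theorem corollary3p9 (R : realType) (n m : nat) (hn : (3 <= n)%N) (hm : (0 < m)%N)
    (L : {linear {ffun 'I_m -> 'M[R]_n} -> 'rV[R]_2})
    (A : {ffun 'I_m -> 'M[R]_n}) :
  convex_set (L @` O1 A) /\ convex_set (L @` O2 A).
Proof.
split.
  rewrite /O1 image_comp; apply: linear_image_SO_convex => // a U V /=.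
  by rewrite -linearP; congr (L _); apply/ffunP=> i; rewrite !ffunE mulmxDr -scalemxAr.
rewrite /O2 image_comp; apply: linear_image_SO_convex => // a U V /=.
by rewrite -linearP; congr (L _); apply/ffunP=> i; rewrite !ffunE mulmxDl -scalemxAl.
Qed.
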